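(* If $G$ is a super-minimally $3$-connected graph, then $|E(G)|\le 2|V(G)|-2$. Moreover, equality holds if and only if $G$ is a wheel with at least three spokes.
   Context: All graphs are finite and simple. A graph is $k$-connected if it has more than $k$ vertices and no vertex cut of size less than $k$. A graph $G$ is super-minimally $k$-connected if $G$ is $k$-connected but no proper subgraph of $G$ is $k$-connected. A wheel with $n$ spokes is obtained from a cycle on $n$ vertices (the rim) by adding a new vertex (the hub) adjacent to every rim vertex. *)

(* Defs.v *)
From mathcomp Require Import all_boot.

Set Implicit Arguments.
Unset Strict Implicit.
Unset Printing Implicit Defensive.

(* The validity condition is boolean, hence proof-irrelevant: two graphs are
   equal exactly when their vertex sets and edge sets are. *)
Record graph (T : finType) := Graph {
  vset : {set T};
  eset : {set {set T}};
  _ : [forall e in eset, (e \subset vset) && (#|e| == 2)]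
}.

Section GraphTheory.
Variable T : finType.
Implicit Types (G H : graph T) (S : {set T}) (c : seq T).

Definition adj G : rel T := [rel x y | [set x; y] \in eset G].

Lemma del_vertices_subproof G S :
  [forall e in [set e in eset G | [disjoint e & S]],
     (e \subset vset G :\: S) && (#|e| == 2)].
Proof.
case: G => V E /= /forall_inP validE; apply/forall_inP => e.
by rewrite inE subsetD => /andP[/validE/andP[-> ->] ->].
Qed.

Definition del_vertices G S : graph T := Graph (del_vertices_subproof G S).

(* The empty graph counts as connected; this does not affect k_connected, where
   at least two vertices always remain after deleting fewer than k. *)
Definition connected G : bool :=
  [forall x in vset G, forall y in vset G, connect (adj G) x y].

Definition vertex_cut G S : bool :=
  (S \subset vset G) && ~~ connected (del_vertices G S).

Definition k_connected (k : nat) G : bool :=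
  (k < #|vset G|) && [forall S : {set T}, vertex_cut G S ==> ~~ (#|S| < k)].

Definition subgraph H G : bool :=
  (vset H \subset vset G) && (eset H \subset eset G).

Definition proper_subgraph H G : Prop := subgraph H G /\ H <> G.

Definition super_minimally_connected (k : nat) G : Prop :=
  k_connected k G /\ forall H, proper_subgraph H G -> ~~ k_connected k H.

(* Edges of the cycle that visits c in order and returns to its start; this is
   a genuine cycle when c is duplicate-free of length at least 3. *)
Definition cycle_edges c : {set {set T}} := [set [set x; next c x] | x in c].

Definition wheel (n : nat) G : Prop :=
  exists (h : T) (c : seq T),
    [/\ size c = n, uniq (h :: c), vset G = [set x in h :: c]
      & eset G = cycle_edges c :|: [set [set h; x] | x in c]].

End GraphTheory.

(* Main.v *)
(* Call a subgraph [(V, E)] of [G] with a set [B] of branch vertices linked when it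
   behaves like a subdivision of a 3-connected graph on [B].  As [G] is
   3-connected, a linked subgraph in which some vertex is not a branch vertex
   admits an ear from a non-branch vertex [x] to a vertex not trapped with [x]
   behind a 2-vertex cut; after adding it, [x] may join [B].  This raises [|E|] by
   exactly as much as [|V| + |B|], and when [B = V] the subgraph is
   3-connected, hence equal to [G].  Starting from a subdivided [K_4], where
   [|E| = |V| + |B| - 2], gives [|E(G)| <= 2 |V(G)| - 2].  If equality holds, no
   linked subgraph has [|E| <= |V| + |B| - 3].  Take a subdivided wheel with the
   most spokes.  If a thread of it has an interior vertex, an ear leads from the
   interior of the thread to elsewhere.  It cannot end at the hub, by
   maximality.  Nor can it end inside another thread, since both ends would
   become branch vertices.  Ending at a rim branch vertex reduces to the first
   case for [K_4] (make that vertex the hub) and to the second one otherwise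
   (delete the spoke at that vertex).  So nothing is subdivided and [G] is the wheel. *)
Require Import Defs.
From mathcomp Require Import all_boot zify.

Set Implicit Arguments.
Unset Strict Implicit.
Unset Printing Implicit Defensive.

(** * Neighbourhoods of vertex sets and the paths that leave them *)

Section Neighbours.
Variable T : finType.
Implicit Types (E : {set {set T}}) (V W B S : {set T}) (x y : T) (p q : seq T).

Definition edge_rel E : rel T := [rel x y | [set x; y] \in E].

Lemma edge_rel_sym E : symmetric (edge_rel E).
Proof. by move=> x y; rewrite /edge_rel /= setUC. Qed.

Lemma path_edge_relS E E' x p :
  E \subset E' -> path (edge_rel E) x p -> path (edge_rel E') x p.
Proof. by move=> sEE'; apply: sub_path => a b; apply: (subsetP sEE'). Qed.

Lemma path_rev_ends (e : rel T) a p b :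
  symmetric e -> path e a (rcons p b) -> path e b (rcons (rev p) a).
Proof.
move=> sym_e; rewrite -(eq_path (e := fun z : T => e^~ z)) => [h|x y]; last exact: sym_e.
by have := rev_path e a (rcons p b); rewrite last_rcons belast_rcons rev_cons h => ->.
Qed.

(** Small cuts appear as neighbourhoods of vertex sets instead of deleted sets, which makes
    submodularity available. *)
Definition nbr E W := [set v | (v \notin W) && [exists w in W, edge_rel E w v]].

Lemma nbrP E W v :
  reflect (v \notin W /\ exists2 w, w \in W & edge_rel E w v) (v \in nbr E W).
Proof.
rewrite inE; apply: (iffP andP) => [[-> /exists_inP h]|[-> h]]; split=> //.
exact/exists_inP.
Qed.

Lemma nbrS E E' W : E \subset E' -> nbr E W \subset nbr E' W.
Proof.
move=> sEE'; apply/subsetP => v /nbrP[vW [w wW wv]]; apply/nbrP; split=> //.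
by exists w => //; apply: (subsetP sEE').
Qed.

Lemma nbr_sub V E W : (forall e, e \in E -> e \subset V) -> nbr E W \subset V.
Proof.
move=> EV; apply/subsetP => v /nbrP[_ [w _ /EV/subsetP]]; apply.
by rewrite !inE eqxx orbT.
Qed.

(** Inclusion-exclusion on both sides reduces this to two inclusions: the union of the left-hand
    sets lies in the union of the right-hand ones, and likewise for the intersections. *)
Lemma card_nbr_submod E W W' :
  #|nbr E (W :|: W')| + #|nbr E (W :&: W')| <= #|nbr E W| + #|nbr E W'|.
Proof.
rewrite -cardsUI -[leqRHS]cardsUI leq_add //; apply: subset_leq_card; apply/subsetP=> v.
  case/setUP=> /nbrP[]; rewrite inE.
    rewrite negb_or => /andP[vW vW'] [w /setUP[] wW wv]; apply/setUP; [left|right];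
    by apply/nbrP; split=> //; exists w.
  case vW: (v \in W) => /= vW' [w /setIP[wW wW'] wv]; apply/setUP; [right|left];
  by apply/nbrP; split=> //; rewrite ?vW //; exists w.
case/setIP=> /nbrP[]; rewrite inE negb_or => /andP[vW vW'] _ /nbrP[_ [w /setIP[wW wW'] wv]].
by apply/setIP; split; apply/nbrP; split=> //; exists w.
Qed.

(** Lets a cut be read from its far side: no edge joins [W] to the complement of its closed
    neighbourhood. *)
Lemma nbr_compl E W : nbr E (~: (W :|: nbr E W)) \subset nbr E W.
Proof.
apply/subsetP => v /nbrP[]; rewrite in_setC negbK => /setUP[vW|//] [w].
rewrite in_setC in_setU negb_or => /andP[wW /negP wN] wv; case: wN.
by apply/nbrP; split=> //; exists v => //; rewrite edge_rel_sym.
Qed.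

Lemma path_leaves E W x p :
  path (edge_rel E) x p -> x \in W -> last x p \notin W ->
  exists2 z, z \in p & z \in nbr E W.
Proof.
elim: p x => [|z p IHp] x /=; first by move=> _ ->.
case/andP=> xz zp xW lW; have [zW|zW] := boolP (z \in W).
  by have [t tp tN] := IHp z zp zW lW; exists t => //; rewrite inE tp orbT.
by exists z; rewrite ?mem_head //; apply/nbrP; split=> //; exists x.
Qed.

Definition separates E W a b :=
  (a \in W) && (b \notin W :|: nbr E W) || (b \in W) && (a \notin W :|: nbr E W).

Lemma path_crosses E W a p b :
  path (edge_rel E) a (rcons p b) -> separates E W a b ->
  exists2 z, z \in p & z \in nbr E W.
Proof.
have cross a' b' p' : path (edge_rel E) a' (rcons p' b') ->
  (a' \in W) && (b' \notin W :|: nbr E W) -> exists2 z, z \in p' & z \in nbr E W.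
  move=> pth /andP[aW]; rewrite in_setU negb_or => /andP[bW bN].
  have [|z] := path_leaves pth aW; first by rewrite last_rcons.
  rewrite mem_rcons inE => /predU1P[->|zp zN]; last by exists z.
  by rewrite (negPf bN).
move=> pth /orP[/(cross _ _ _ pth)//|].
have := path_rev_ends (@edge_rel_sym E) pth => /cross h /h[z zp zN].
by exists z => //; rewrite -mem_rev.
Qed.

(** The easy half of Menger's theorem: each of the three internally disjoint paths meets the
    neighbourhood in its interior. *)
Lemma separated_by_three E W a b p1 p2 p3 :
  path (edge_rel E) a (rcons p1 b) -> path (edge_rel E) a (rcons p2 b) ->
  path (edge_rel E) a (rcons p3 b) -> uniq (p1 ++ p2 ++ p3) ->
  separates E W a b -> 2 < #|nbr E W|.
Proof.
move=> h1 h2 h3 + sab.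
have [z1 i1 n1] := path_crosses h1 sab; have [z2 i2 n2] := path_crosses h2 sab.
have [z3 i3 n3] := path_crosses h3 sab.
rewrite cat_uniq has_cat negb_or cat_uniq => /and3P[_ /andP[/hasPn d12 /hasPn d13]].
case/and3P=> _ /hasPn d23 _.
have z12 : z1 != z2 by apply: contraTneq i1 => ->; apply: d12.
have z13 : z1 != z3 by apply: contraTneq i1 => ->; apply: d13.
have z23 : z2 != z3 by apply: contraTneq i2 => ->; apply: d23.
apply: leq_trans (subset_leq_card (_ : [set z1; z2; z3] \subset _)).
  by rewrite -setUA !cardsU1 cards1 !inE negb_or z12 z13 z23.
by rewrite !subUset !sub1set n1 n2.
Qed.

(** Walking from [x] towards either end, the path must leave [W]; the two exits lie on different
    sides of [x] on a simple path, hence differ. *)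
Lemma thread_nbrs E W u p v x :
  path (edge_rel E) u (rcons p v) -> uniq (u :: rcons p v) -> x \in p -> x \in W ->
  u \notin W -> v \notin W ->
  exists z1 z2, [/\ z1 \in u :: p, z2 \in rcons p v, z1 != z2, z1 \in nbr E W
                  & z2 \in nbr E W].
Proof.
move=> pth un xp xW uW vW; case/splitPr: xp pth un => p1 p2.
rewrite rcons_cat rcons_cons cat_path /= => /and3P[up1 lx xp2] /andP[un1 un2].
have [|z2 i2 n2] := path_leaves xp2 xW; first by rewrite last_rcons.
have /(path_rev_ends (@edge_rel_sym E)) pth1 : path (edge_rel E) u (rcons p1 x).
  by rewrite rcons_path up1.
have [|z1 i1 n1] := path_leaves pth1 xW; first by rewrite last_rcons.
exists z1, z2; rewrite mem_rcons !inE mem_rev in i1; split=> //.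
- by rewrite inE mem_cat; case/orP: i1 => ->; rewrite ?orbT.
- by rewrite mem_cat inE i2 !orbT.
- apply: contraTneq i1 => e; rewrite {}e in n1 *; rewrite negb_or; apply/andP; split.
    by apply: contraNneq un1 => <-; rewrite mem_cat inE i2 !orbT.
  move: un2; rewrite cat_uniq => /and3P[_ /hasPn d _]; apply: d.
  by rewrite inE i2 orbT.
Qed.

Fixpoint path_edges x p : {set {set T}} :=
  if p is y :: p' then [set x; y] |: path_edges y p' else set0.

Lemma path_edgesP E x p : path (edge_rel E) x p = (path_edges x p \subset E).
Proof.
elim: p x => [|y p IHp] x /=; first by rewrite sub0set.
by rewrite subUset sub1set IHp.
Qed.

Lemma card_path_edges x p : #|path_edges x p| <= size p.
Proof.
elim: p x => [|y p IHp] x /=; first by rewrite cards0.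
by rewrite cardsU1; have := IHp y; case: (_ \notin _) => /=; lia.
Qed.

Lemma path_edges_in x p e : e \in path_edges x p -> e \subset [set z in x :: p].
Proof.
elim: p x => [|y p IHp] x /=; first by rewrite inE.
case/setU1P=> [->|/IHp/subsetP h].
  by apply/subsetP => z; rewrite !inE => /orP[]->; rewrite ?orbT.
by apply/subsetP => z /h; rewrite !inE => ->; rewrite orbT.
Qed.

(* Models a subdivision [(V, E)] of a 3-connected multigraph with branch vertices
   [B]: only cuts that leave branch vertices on both sides must have size 3. *)
Record linked3 V E B : Prop := Linked3 {
  linked3_sub : B \subset V;
  linked3_card : 3 < #|B|;
  linked3_2 : forall W x,
    x \in V -> x \in W -> [disjoint W & B] -> 1 < #|nbr E W|;
  linked3_3 : forall W b b',
    b \in B -> b' \in B -> b \in W -> b' \notin W :|: nbr E W -> 2 < #|nbr E W|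
}.

(** If [W] contains [x] and meets [B], a branch vertex in [W] can stand in for [x]; only the sets
    missing [B] need the new hypothesis. *)
Lemma linked3_add V E B x : linked3 V E B -> x \in V ->
  (forall W, x \in W -> [disjoint W & B] -> 2 < #|nbr E W|) ->
  linked3 V E (x |: B).
Proof.
case=> sB cB l2 l3 xV wx; split.
- by rewrite subUset sub1set xV.
- by apply: leq_trans cB _; apply/subset_leq_card/subsetUr.
- move=> W y yV yW; rewrite disjoint_sym => dW; apply: l2 yV yW _.
  by rewrite disjoint_sym; apply: disjointWl dW; apply: subsetUr.
have wx' W b : x \in W -> b \in B -> b \notin W :|: nbr E W -> 2 < #|nbr E W|.
  move=> xW bB bW; have [d|] := boolP [disjoint W & B]; first exact: wx.
  by rewrite -setI_eq0 => /set0Pn[c /setIP[cW cB']]; apply: l3 cB' bB cW bW.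
move=> W b b' /setU1P[->|bB] /setU1P[->|bB'] bW b'W.
- by move: b'W; rewrite inE bW.
- exact: wx' b'W.
(* Here [x] is the vertex beyond the cut, so the cut is read from the other side. *)
- apply: leq_trans (subset_leq_card (nbr_compl E W)).
  apply: (wx' _ b) => //; first by rewrite in_setC.
  rewrite in_setU negb_or in_setC negbK in_setU bW /=.
  by apply: contraL bW => /(subsetP (nbr_compl E W))/nbrP[].
- exact: l3 bW b'W.
Qed.

(** * Adding an ear to a linked subgraph *)

Section Ear.
Variables (V B : {set T}) (E : {set {set T}}) (x y : T) (q : seq T).
Hypotheses (lk : linked3 V E B) (EV : forall e, e \in E -> e \subset V).
Hypotheses (xV : x \in V) (yV : y \in V) (xy : x != y) (uq : uniq q).
Hypothesis qV : forall z, z \in q -> z \notin V.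

Definition ear_verts := V :|: [set z in q].
Definition ear_edges := E :|: path_edges x (rcons q y).

Lemma card_ear_verts : #|ear_verts| = #|V| + size q.
Proof.
rewrite cardsU cardsE (card_uniqP uq) (_ : _ :&: _ = set0) ?cards0 ?subn0 //.
apply/setP => z; rewrite !inE; apply/negP => /andP[zV zq].
by move: (qV zq); rewrite zV.
Qed.

Lemma card_ear_edges : #|ear_edges| <= #|E| + (size q).+1.
Proof.
apply: leq_trans (leq_card_setU _ _) _.
by rewrite leq_add2l; have := card_path_edges x (rcons q y); rewrite size_rcons.
Qed.

Lemma ear_edges_in e : e \in ear_edges -> e \subset ear_verts.
Proof.
case/setUP=> [/EV eV|/path_edges_in eq].
  by apply: subset_trans eV _; apply: subsetUl.
apply: subset_trans eq _; apply/subsetP => z.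
rewrite !inE mem_rcons inE => /or3P[/eqP->|/eqP->|->];
by rewrite ?xV ?yV ?orbT.
Qed.

Lemma ear_path : path (edge_rel ear_edges) x (rcons q y).
Proof. by rewrite path_edgesP subsetUr. Qed.

(** A set meeting [V] keeps its old neighbours; one that misses [V] contains an interior vertex of
    the ear, and the ear leaves it in both directions. *)
Lemma ear_linked : linked3 ear_verts ear_edges B.
Proof.
case: lk => sB cB l2 l3; have sE : E \subset ear_edges by apply: subsetUl.
split=> //; first by apply: subset_trans sB _; apply: subsetUl.
- move=> W w wV' wW dW; have [dV|] := boolP [disjoint W & V]; last first.
    rewrite -setI_eq0 => /set0Pn[z /setIP[zW zV]].
    by apply: leq_trans (l2 W z zV zW dW) _; apply/subset_leq_card/nbrS.
  have xW : x \notin W by apply: contraL xV => /(disjointFr dV)->.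
  have yW : y \notin W by apply: contraL yV => /(disjointFr dV)->.
  have wq : w \in q by move: wV'; rewrite !inE (disjointFr dV wW).
  have [|z1 [z2 [_ _ z12 n1 n2]]] := thread_nbrs ear_path _ wq wW xW yW.
    rewrite /= mem_rcons inE (negPf xy) rcons_uniq uq andbT.
    by apply/andP; split; apply/negP => /qV; rewrite ?xV ?yV.
  apply: leq_trans (subset_leq_card (_ : [set z1; z2] \subset _)); first by rewrite cards2 z12.
  by rewrite subUset !sub1set n1.
- move=> W b b' bB b'B bW; rewrite in_setU negb_or => /andP[b'W b'N].
  apply: leq_trans (subset_leq_card (nbrS W sE)); apply: l3 bB b'B bW _.
  by rewrite in_setU negb_or b'W; apply: contra b'N; apply/subsetP/nbrS.
Qed.

(** Followed from its end in [W], the ear exits either at an interior vertex, which is outside [V],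
    or at its other end, which is no old neighbour. *)
Lemma ear_nbr W : separates E W x y -> #|nbr E W| < #|nbr ear_edges W|.
Proof.
move=> sep; have sE : E \subset ear_edges by apply: subsetUl.
have nV z : z \in nbr E W -> z \in V by apply/subsetP/nbr_sub.
have lift a b p : path (edge_rel ear_edges) a (rcons p b) -> p =i q ->
    (a \in W) && (b \notin W :|: nbr E W) -> exists2 z, z \in nbr ear_edges W & z \notin nbr E W.
  move=> pth pq /andP[aW]; rewrite in_setU negb_or => /andP[bW bN].
  have [|z] := path_leaves pth aW; first by rewrite last_rcons.
  rewrite mem_rcons inE pq => /predU1P[->|zq] zN; first by exists b.
  by exists z => //; apply: contra (qV zq); apply: nV.
have [z zN zE] : exists2 z, z \in nbr ear_edges W & z \notin nbr E W.
  case/orP: sep => h; first exact: lift ear_path _ h.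
  apply: lift h; first exact/path_rev_ends/ear_path/edge_rel_sym.
  exact: mem_rev.
by apply: proper_card; rewrite properE nbrS //; apply/subsetPn; exists z.
Qed.

(** A set at [x] missing [B] has at least two neighbours already; if it has just two, [y] lies
    beyond them and the ear supplies the third. *)
Lemma ear_linked1 :
  (forall W, x \in W -> [disjoint W & B] -> #|nbr E W| <= 2 -> y \notin W :|: nbr E W) ->
  linked3 ear_verts ear_edges (x |: B).
Proof.
move=> indep; apply: linked3_add ear_linked _ _; first by rewrite in_setU xV.
move=> W xW dW; have [W2|] := leqP #|nbr E W| 2; last first.
  by move/leq_trans; apply; apply/subset_leq_card/nbrS/subsetUl.
apply: leq_trans _ (ear_nbr _); last by rewrite /separates xW indep.
by rewrite ltnS; apply: linked3_2 lk _ _ xV xW dW.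
Qed.

(** Here one ear creates two branch vertices, so [|V| + |B|] rises by one more than [|E|] can. *)
Lemma ear_linked2 :
  (forall W, x \in W -> [disjoint W & B] -> #|nbr E W| <= 2 -> y \notin W :|: nbr E W) ->
  (forall W, y \in W -> [disjoint W & B] -> #|nbr E W| <= 2 -> x \notin W :|: nbr E W) ->
  linked3 ear_verts ear_edges (y |: (x |: B)).
Proof.
move=> indepx indepy; apply: linked3_add (ear_linked1 indepx) _ _.
  by rewrite in_setU yV.
move=> W yW; rewrite disjoint_sym => /disjointWl dW.
have {}dW : [disjoint W & B] by rewrite disjoint_sym; apply: dW; apply: subsetUr.
have [W2|] := leqP #|nbr E W| 2; last first.
  by move/leq_trans; apply; apply/subset_leq_card/nbrS/subsetUl.
apply: leq_trans _ (ear_nbr _); last by rewrite /separates yW indepy ?orbT.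
by rewrite ltnS; apply: linked3_2 lk _ _ yV yW dW.
Qed.

End Ear.

(** The ear runs from the last vertex of [A] before the first vertex of [D] on the given path. *)
Lemma ear_exists (e : rel T) (A D S : {set T}) x p :
  path e x p -> uniq (x :: p) -> x \in A -> last x p \in D -> [disjoint A & D] ->
  (forall z, z \in p -> z \notin S) ->
  exists a b q, [/\ a \in A, b \in D, path e a (rcons q b), uniq q
                  & forall z, z \in q -> z \notin A :|: D :|: S].
Proof.
move=> + + + + dAD.
(* Here [q] is the stretch walked since the latest visit to [A]; it is emptied whenever the path
   returns to [A]. *)
suff: forall q x, path e x (q ++ p) -> uniq (q ++ p) -> x \in A ->
    (forall z, z \in q -> z \notin A :|: D :|: S) -> last x (q ++ p) \in D ->
    (forall z, z \in p -> z \notin S) ->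
  exists a b q, [/\ a \in A, b \in D, path e a (rcons q b), uniq q
                  & forall z, z \in q -> z \notin A :|: D :|: S].
  move=> h xp /= /andP[_ up] xA lD pS.
  by apply: (h [::] x).
elim: p => [|z p IHp] q {}x.
  rewrite cats0 => _ _ xA qN lD _; case/lastP: q => [|q z] in qN lD *.
    by move: lD; rewrite /= (disjointFr dAD xA).
  have := qN z; rewrite mem_rcons mem_head last_rcons in lD * => /(_ isT).
  by rewrite !in_setU lD orbT.
move=> pth un xA qN lD pS.
have pS' t : t \in p -> t \notin S by move=> tp; apply: pS; rewrite inE tp orbT.
move: pth un lD; rewrite cat_path cat_uniq last_cat /= => /and3P[xq qz zp].
case/and4P=> uq /norP[zq pq] zp' up lD.
have [zA|zA] := boolP (z \in A); first by apply: (IHp [::] z).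
have [zD|zD] := boolP (z \in D).
  by exists x, z, q; rewrite rcons_path xq.
apply: (IHp (rcons q z) x) => //.
- by rewrite cat_rcons cat_path /= xq qz.
- by rewrite cat_rcons cat_uniq /= uq negb_or zq pq zp'.
- move=> t; rewrite mem_rcons inE => /predU1P[->|/qN//].
  by rewrite !in_setU !negb_or zA zD pS ?mem_head.
- by rewrite cat_rcons last_cat.
Qed.

End Neighbours.

(** * From linked subgraphs to 3-connectivity, and ears in a 3-connected graph *)

Section ThreeConnected.
Variables (T : finType) (G : graph T).
Implicit Types (E : {set {set T}}) (V W B S A D : {set T}) (x y : T) (p q : seq T).

Lemma esetP e : e \in eset G -> e \subset vset G /\ #|e| = 2.
Proof. by case: G => V E /= /forall_inP h /h/andP[? /eqP]. Qed.

Lemma adj_vset x y : edge_rel (eset G) x y -> y \in vset G.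
Proof. by move=> /esetP[/subsetP + _]; apply; rewrite !inE eqxx orbT. Qed.

Lemma path_vset x p : path (edge_rel (eset G)) x p -> {subset p <= vset G}.
Proof.
elim: p x => [//|y p IHp] x /= /andP[/adj_vset yG /IHp pG] z.
by rewrite inE => /predU1P[->|/pG].
Qed.

(** The set of vertices reachable from [x] once [S] is deleted has all its neighbours in [S]; if it
    misses [y], linkedness forces three of them. *)
Lemma linked3_k_connected V E (valid : [forall e in E, (e \subset V) && (#|e| == 2)]) :
  linked3 V E V -> k_connected 3 (Graph valid).
Proof.
case=> _ cV _ l3; rewrite /k_connected cV /=; apply/forallP => S; apply/implyP.
case/andP=> /= sSV; apply: contraNN => cS; apply/forall_inP => x xV; apply/forall_inP => y yV.
move: xV yV; rewrite !inE => /andP[xS xV] /andP[yS yV]; apply: contraTT cS => nxy.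
rewrite -leqNgt; pose e := adj (del_vertices (Graph valid) S).
pose W := [set z | connect e x z].
have NS : nbr E W \subset S.
  apply/subsetP => v /nbrP[vW [w wW wv]]; apply: contraR vW => vS; rewrite inE.
  move: wW; rewrite inE => xw; apply: (connect_trans xw); apply: connect1.
  rewrite /e /adj /= inE; apply/andP; split; first exact: wv.
  have wS : w \notin S.
    case/connectP: xw => r; case/lastP: r => [|r t] /= pr ->; first by [].
    move: pr; rewrite rcons_path last_rcons => /andP[_]; rewrite /e /adj /= inE => /andP[_].
    by move/disjointFr=> -> //; rewrite !inE eqxx orbT.
  by rewrite disjoints_subset subUset !sub1set !in_setC wS vS.
apply: leq_trans (subset_leq_card NS).
apply: l3 xV yV _ _; first by rewrite inE connect0.
by rewrite in_setU negb_or inE nxy (contra (subsetP NS y)).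
Qed.

Hypothesis kG : k_connected 3 G.

Lemma vset_card : 3 < #|vset G|.
Proof. by case/andP: kG. Qed.

Lemma avoiding_path S x y : S \subset vset G -> #|S| <= 2 ->
  x \in vset G :\: S -> y \in vset G :\: S ->
  exists p, [/\ path (edge_rel (eset G)) x p, uniq (x :: p), y = last x p
              & forall z, z \in p -> z \notin S].
Proof.
move=> sS cS xG yG; case/andP: kG => _ /forallP/(_ S).
rewrite /vertex_cut sS /= ltnS cS implybF negbK => /forall_inP/(_ x xG)/forall_inP/(_ y yG).
case/connectP=> p0 /shortenP[p pth up _] ->; exists p; split=> //.
  by apply: sub_path pth => a b; rewrite /adj /= inE => /andP[].
elim: p x pth {xG up} => [//|z p IHp] x /= /andP[]; rewrite {1}/adj /= inE => /andP[_ dS] /IHp h t.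
by rewrite inE => /predU1P[->|/h//]; rewrite (disjointFr dS) // !inE eqxx orbT.
Qed.

(** Otherwise the neighbours of [x] would form a cut of size at most two, separating [x] from one of
    the remaining vertices. *)
Lemma degree_ge3 x : x \in vset G -> 2 < #|nbr (eset G) [set x]|.
Proof.
move=> xG; rewrite ltnNge; apply/negP => N2; set N := nbr _ _ in N2.
have sN : N \subset vset G by apply/nbr_sub => e /esetP[].
have xN : x \notin N by apply/negP => /nbrP[]; rewrite set11.
have [y] : exists y, y \in vset G :\: (x |: N).
  apply/set0Pn; rewrite setD_eq0; apply/negP => /subset_leq_card.
  by rewrite cardsU1 xN; have := vset_card; move: N2; clear; lia.
rewrite in_setD in_setU1 negb_or -andbA => /and3P[yx yN yG].
have [||p [pth _ e pN]] := avoiding_path (x := x) (y := y) sN N2; rewrite ?in_setD ?xN ?yN //.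
have [|||z /pN zN] := @path_leaves T (eset G) [set x] x p; rewrite ?set11 ?in_set1 -?e //.
by rewrite (negPf zN).
Qed.

Lemma three_connected_ear A D S x y :
  A \subset vset G -> D \subset vset G -> S \subset vset G -> #|S| <= 2 ->
  [disjoint A & D] -> [disjoint A & S] -> [disjoint D & S] -> x \in A -> y \in D ->
  exists a b q, [/\ a \in A, b \in D, path (edge_rel (eset G)) a (rcons q b), uniq q
                  & forall z, z \in q -> z \notin A :|: D :|: S].
Proof.
move=> /subsetP sA /subsetP sD sS cS dAD dAS dDS xA yD.
have [||p [pth up e pS]] := avoiding_path (x := x) (y := y) sS cS.
- by rewrite inE sA // (disjointFr dAS).
- by rewrite inE sD // (disjointFr dDS).
by apply: ear_exists pth up xA _ dAD pS; rewrite -e.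
Qed.

End ThreeConnected.

(** * The edge bound obtained from any linked subgraph *)

Section SuperMinimal.
Variables (T : finType) (G : graph T).
Implicit Types (E : {set {set T}}) (V W B S A D : {set T}) (x y : T) (p q : seq T).
Hypothesis hG : super_minimally_connected 3 G.
Let kG : k_connected 3 G := proj1 hG.

Lemma super_minimal_eq V E : V \subset vset G -> E \subset eset G ->
  (forall e, e \in E -> e \subset V) -> linked3 V E V -> V = vset G /\ E = eset G.
Proof.
move=> sV sE EV lk.
have valid : [forall e in E, (e \subset V) && (#|e| == 2)].
  by apply/forall_inP => e eE; rewrite EV //=; have [_ ->] := esetP (subsetP sE e eE).
have kH := linked3_k_connected valid lk.
have [/andP[/eqP-> /eqP->] //|neq] := boolP ((V == vset G) && (E == eset G)).
suff /(hG.2 _) : proper_subgraph (Graph valid) G by rewrite kH.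
split; first by rewrite /subgraph /= sV sE.
by move=> e; move: neq; rewrite -e /= !eqxx.
Qed.

(* Each step enlarges [B] and does not decrease [|V| + |B| - |E|], until [B = V].
   A maximal weak set [W] with ear [a .. b] leaving it works because, by
   submodularity, it absorbs every other weak set containing [a]. *)
Lemma linked3_bound V E B c : V \subset vset G -> E \subset eset G ->
  (forall e, e \in E -> e \subset V) -> linked3 V E B ->
  #|E| + c <= #|V| + #|B| -> #|eset G| + c <= 2 * #|vset G|.
Proof.
have [n] := ubnP (#|vset G| - #|B|); elim: n V E B => // n IHn V E B.
move=> ltn sV sE EV lk le; have [/eqP eqBV|] := boolP (B == V).
  rewrite eqBV in lk le; have [<- <-] := super_minimal_eq sV sE EV lk.
  by rewrite mul2n -addnn.
move=> neqBV; have [sB cB _ _] := lk.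
have [x xV xB] : exists2 x, x \in V & x \notin B.
  by apply/subsetPn; apply: contra neqBV => sVB; rewrite eqEsubset sB.
have ltB a : a \in V -> a \notin B -> #|vset G| - #|a |: B| < n.
  move=> aV aB; suff: #|a |: B| <= #|vset G|.
    by rewrite !cardsU1 aB; move: ltn; clear; lia.
  by apply/subset_leq_card/(subset_trans _ sV); rewrite subUset sub1set aV.
(* The weak sets containing [x] are the obstacles to applying [linked3_add] at [x]. *)
pose weak W := [disjoint W & B] && (#|nbr E W| <= 2).
have [W0 /andP[xW0 wkW0]|noweak] := pickP (fun W : {set T} => (x \in W) && weak W); last first.
  (* Without an obstacle, [x] joins [B] and no ear is added. *)
  apply: IHn (ltB x xV xB) sV sE EV _ _; last by rewrite cardsU1 xB; move: le; clear; lia.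
  by apply: linked3_add lk xV _ => W xW dW; have := noweak W; rewrite /weak xW dW /= ltnNge => ->.
have [W /maxsetP[/andP[dW cW] maxW] sW0] := maxset_exists wkW0.
have xW := subsetP sW0 x xW0; pose N := nbr E W.
have sNV : N \subset V by apply: nbr_sub.
pose A := W :&: V; pose D := V :\: (W :|: N).
have [z zD] : exists z, z \in D.
  (* There are more than three branch vertices, none of them in [W], and at most two can be in
     [N]. *)
  have /subsetPn[z zB zN] : ~~ (B \subset N).
    by apply/negP => /subset_leq_card; move: cW cB; rewrite -/N; clear; lia.
  by exists z; rewrite inE (subsetP sB) // in_setU negb_or zN (disjointFl dW).
have [|||||||||a [b [q [aA bD pth uq qN]]]] :=
  three_connected_ear kG (A := A) (D := D) (S := N) (x := x) (y := z).
- by apply: subset_trans sV; apply: subsetIr.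
- by apply: subset_trans sV; apply: subsetDl.
- exact: subset_trans sV.
- exact: cW.
- by rewrite disjoints_subset; apply/subsetP=> t /setIP[tW _]; rewrite in_setC in_setD in_setU tW.
- rewrite disjoints_subset; apply/subsetP=> t /setIP[tW _]; rewrite in_setC.
  by apply/negP => /nbrP[/negP tW' _]; apply: tW'.
- rewrite disjoints_subset; apply/subsetP=> t /setDP[_]; rewrite in_setC in_setU.
  by rewrite negb_or => /andP[].
- by rewrite inE xW.
- exact: zD.
have /setIP[aW aV] := aA; have /setDP[bV bWN] := bD.
have ab : a != b by apply: contraNneq bWN => <-; rewrite in_setU aW.
have qV t : t \in q -> t \notin V.
  move/qN; apply: contra => tV; rewrite !in_setU in_setI in_setD in_setU tV.
  by case: (t \in W) => //; case: (t \in N).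
have aB : a \notin B by rewrite (disjointFr dW).
apply: (IHn (ear_verts V q) (ear_edges E a b q) (a |: B) (ltB a aV aB)).
- rewrite subUset sV /=; apply/subsetP => t; rewrite inE => tq.
  by apply: (path_vset pth); rewrite mem_rcons inE tq orbT.
- by rewrite subUset sE -path_edgesP.
- exact: ear_edges_in.
- apply: ear_linked1 => // U aU dU cU.
  have wk : weak (W :|: U).
    rewrite /weak; apply/andP; split.
      by rewrite disjoints_subset subUset -!disjoints_subset dW.
    (* The intersection contains [a], so it has at least two neighbours; submodularity then leaves
       at most two for the union. *)
    have := linked3_2 lk aV (W := W :&: U); rewrite inE aW aU => /(_ isT).
    rewrite (disjointWl (subsetIl _ _)) // => /(_ isT).
    by have := card_nbr_submod E W U; move: cW cU; clear; lia.
  have eU := maxW _ wk (subsetUl _ _); have sUW : U \subset W by rewrite -eU subsetUr.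
  apply: contra bWN; rewrite !in_setU => /orP[/(subsetP sUW)->//|/nbrP[bU [w wU wb]]].
  have [//|bW] := boolP (b \in W); apply/nbrP; split=> //.
  by exists w => //; apply: (subsetP sUW).
- rewrite (card_ear_verts uq qV) cardsU1 aB.
  by have := card_ear_edges E a b q; move: le; clear; lia.
Qed.

End SuperMinimal.

(** * Occurrence counts and cyclic successors in sequences *)

Section Occurrences.
Variable T : eqType.
Implicit Types (x y : T) (s : seq T).

(** Duplicate-freeness and disjointness of concatenated sequences become linear inequalities in
    these counts, within reach of [lia]. *)
Definition occ x s : nat := count_mem x s.

Lemma occ_nil x : occ x [::] = 0. Proof. by []. Qed.
Lemma occ_cons x y s : occ x (y :: s) = (y == x) + occ x s. Proof. by []. Qed.
Lemma occ_rcons x y s : occ x (rcons s y) = (y == x) + occ x s.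
Proof. by rewrite /occ -cats1 count_cat /= addn0 addnC. Qed.
Lemma occ_cat x s t : occ x (s ++ t) = occ x s + occ x t.
Proof. exact: count_cat. Qed.
Lemma occ_rev x s : occ x (rev s) = occ x s.
Proof. exact: count_rev. Qed.
Lemma occ_gt0 x s : (0 < occ x s) = (x \in s).
Proof. by rewrite -has_count has_pred1. Qed.

Definition occE := (occ_nil, occ_cons, occ_rcons, occ_cat, occ_rev).

Lemma uniq_occP s : reflect (forall x, occ x s <= 1) (uniq s).
Proof.
apply: (iffP idP) => [us x|h]; first by rewrite /occ count_uniq_mem // leq_b1.
apply: count_mem_uniq => x; have := h x; rewrite -occ_gt0.
by rewrite /occ; case: (count_mem x s) => [|[]].
Qed.

End Occurrences.

Section CyclicSuccessor.
Variables (T : eqType) (s : seq T) (x : T).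
Hypotheses (us : uniq s) (xs : x \in s).

Lemma next_neq : 1 < size s -> next s x != x.
Proof.
have [n s' e] := rot_to xs; move: us; rewrite -(size_rot n) -(next_rot n us) -(rot_uniq n) e.
by case: s' {e} => //= y s'; rewrite inE negb_or eqxx eq_sym => /andP[/andP[->]].
Qed.

Lemma next_next_neq : 2 < size s -> next s (next s x) != x.
Proof.
have [n s' e] := rot_to xs.
move: us; rewrite -(size_rot n) -!(next_rot n us) -(rot_uniq n) e.
case: s' {e} => [|y [|z s']] //=; rewrite !inE !negb_or ?eqxx.
by case/andP=> /and3P[/negPf xy xz _] _; rewrite [y == x]eq_sym xy ?eqxx eq_sym.
Qed.

End CyclicSuccessor.

(** * Subdivided wheels and their threads *)

Section SubdividedWheels.
Variable T : finType.
(* A triple [(p, r, t)] stands for a spoke from the hub to the rim vertex [r]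
   with interior [p], together with the segment from [r] to the next rim vertex,
   with interior [t]. *)
Definition sector := (seq T * T * seq T)%type.
Implicit Types (E : {set {set T}}) (V W B : {set T}) (h x y z : T) (p q c : seq T).
Implicit Types (d : sector) (D : seq sector) (i j : bool * sector).

Definition spoke d := d.1.1.
Definition corner d := d.1.2.
Definition segment d := d.2.
Definition spokes D := flatten [seq spoke d | d <- D].
Definition rim D := flatten [seq corner d :: segment d | d <- D].
Definition wheel_verts h D := h :: spokes D ++ rim D.

(** The wheel only has to sit inside [E], which may have further edges; [wheel_edges] below cuts [E]
    down to the wheel. *)
Definition wheel_in E h D :=
  [&& uniq (wheel_verts h D),
      all (fun d => path (edge_rel E) h (rcons (spoke d) (corner d))) D
    & cycle (edge_rel E) (rim D)].

Definition branches h D := [set z in h :: map corner D].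

Lemma spokes_cons d D : spokes (d :: D) = spoke d ++ spokes D.
Proof. by []. Qed.
Lemma rim_cons d D : rim (d :: D) = corner d :: segment d ++ rim D.
Proof. by []. Qed.
Lemma spokes_cat D D' : spokes (D ++ D') = spokes D ++ spokes D'.
Proof. by rewrite /spokes map_cat flatten_cat. Qed.
Lemma rim_cat D D' : rim (D ++ D') = rim D ++ rim D'.
Proof. by rewrite /rim map_cat flatten_cat. Qed.

Lemma wheel_verts_rot h n D : perm_eq (wheel_verts h (rot n D)) (wheel_verts h D).
Proof.
rewrite perm_cons /rot spokes_cat rim_cat -{5 6}(cat_take_drop n D) spokes_cat rim_cat.
by apply: perm_cat; rewrite perm_catC.
Qed.

(** The first sector is an arbitrary choice; rotating brings any sector to the front. *)
Lemma wheel_in_rot E h n D : wheel_in E h (rot n D) = wheel_in E h D.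
Proof.
rewrite /wheel_in (perm_uniq (wheel_verts_rot h n D)).
rewrite (perm_all _ (_ : perm_eq (rot n D) D)) ?perm_rot //; congr [&& _, _ & _].
by rewrite /rot rim_cat -rot_size_cat rot_cycle -rim_cat cat_take_drop.
Qed.

Lemma branches_rot h n D : branches h (rot n D) = branches h D.
Proof. by apply/setP => z; rewrite !inE map_rot mem_rot. Qed.

Lemma mem_spokes D x : reflect (exists2 d, d \in D & x \in spoke d) (x \in spokes D).
Proof. exact: flatten_mapP. Qed.

Lemma mem_rim D x : reflect (exists2 d, d \in D & x \in corner d :: segment d) (x \in rim D).
Proof. exact: flatten_mapP. Qed.

Lemma occ_corners x D : occ x (map corner D) <= occ x (rim D).
Proof.
by elim: D => // d D IHD; rewrite rim_cons map_cons !occE leq_add2l (leq_trans IHD) ?leq_addl.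
Qed.

Section Fixed.
Variables (E : {set {set T}}) (h : T).

Lemma uniq_corners D : wheel_in E h D -> uniq (map corner D).
Proof.
case/and3P=> + _ _ => /uniq_occP u; apply/uniq_occP => x.
by have := u x; have := occ_corners x D; rewrite !occE; clear; lia.
Qed.

Lemma uniq_sectors D : wheel_in E h D -> uniq D.
Proof. by move/uniq_corners/map_uniq. Qed.

(** A thread is coded by a pair: [true] selects the spoke of the sector, directed away from the hub,
    and [false] its segment, directed along the rim. *)
Definition thread_src i := if i.1 then h else corner i.2.
Definition thread_int i := if i.1 then spoke i.2 else segment i.2.
Definition thread_tgt D i := corner (if i.1 then i.2 else next D i.2).

Variable D : seq sector.
Hypotheses (wD : wheel_in E h D) (D3 : 2 < size D).

Lemma wheel_front d : d \in D ->
  exists n d1 D' dl, rot n D = d :: d1 :: rcons D' dl /\ wheel_in E h (d :: d1 :: rcons D' dl).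
Proof.
case/rot_to=> n D' e; exists n; move: (wD) (D3).
rewrite -(wheel_in_rot _ _ n) -(size_rot n) e; case: D' e => // d1 D'.
by case/lastP: D' => // D' dl _ w _; exists d1, D', dl.
Qed.

Lemma wheel_occ n d D' x : rot n D = d :: D' ->
  (h == x) + (occ x (spoke d) + occ x (spokes D')) +
  ((corner d == x) + (occ x (segment d) + occ x (rim D'))) <= 1.
Proof.
move=> e; have /and3P[/uniq_occP u _ _] : wheel_in E h (d :: D') by rewrite -e wheel_in_rot.
by have := u x; rewrite /wheel_verts spokes_cons rim_cons !occE addnA.
Qed.

Lemma thread_int_branch i z : i.2 \in D -> z \in thread_int i -> z \notin branches h D.
Proof.
case: i => b d /= /rot_to[n D1 e].
have := wheel_occ z e; rewrite -(branches_rot _ n) e inE.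
have le := occ_corners z D1.
rewrite map_cons -!occ_gt0 /thread_int !occE; move: le; clear.
by case: b => /=; case: (h == z); case: (corner d == z); lia.
Qed.

Lemma thread_int_inj i j z : i.2 \in D -> j.2 \in D ->
  z \in thread_int i -> z \in thread_int j -> i = j.
Proof.
case: i j => b d [b' d'] /= /rot_to[n D1 e].
have := wheel_occ z e; rewrite -(mem_rot n) e inE.
move=> u d'D; rewrite /thread_int /= => z1 z2.
have zs : d' \in D1 -> z \in spoke d' -> 0 < occ z (spokes D1).
  by move=> dD1 zd; rewrite occ_gt0; apply/mem_spokes; exists d'.
have zr : d' \in D1 -> z \in segment d' -> 0 < occ z (rim D1).
  by move=> dD1 zd; rewrite occ_gt0; apply/mem_rim; exists d'; rewrite // inE zd orbT.
have [eqd|neq] := eqVneq d' d.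
  rewrite eqd in z2 *; case: b b' z1 z2 => -[] //=;
    rewrite -!occ_gt0; move: u; clear; lia.
move: d'D; rewrite (negPf neq) /= => d'D.
have {}zs := zs d'D; have {}zr := zr d'D.
case: b b' z1 z2 => -[] //= z1; first [move/zs | move/zr];
  move: z1; rewrite -?occ_gt0; move: u; clear; lia.
Qed.

Lemma corner_neq_hub d : d \in D -> corner d != h.
Proof.
case/rot_to=> n D1 eD; apply/eqP => e.
by have := wheel_occ h eD; rewrite e eqxx; clear; lia.
Qed.

Lemma corner_inj d d' : d \in D -> d' \in D -> corner d = corner d' -> d = d'.
Proof.
move=> dD d'D e; have u := uniq_corners wD.
have [s s'] := (etrans (index_mem d D) dD, etrans (index_mem d' D) d'D).
rewrite -(nth_index d dD) -(nth_index d d'D); congr nth; apply/eqP.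
by rewrite -(nth_uniq (corner d) _ _ u) ?size_map // !(nth_map d) // !nth_index // e.
Qed.

Lemma mem_corner d : d \in D -> corner d \in branches h D.
Proof. by move=> dD; rewrite !inE map_f ?orbT. Qed.

Lemma hub_branch : h \in branches h D.
Proof. by rewrite !inE eqxx. Qed.

Lemma next_front n d d1 D' : rot n D = d :: d1 :: D' -> next D d = d1.
Proof. by move=> e; rewrite -(next_rot n (uniq_sectors wD)) e /= eqxx. Qed.

Lemma thread_src_branch i : i.2 \in D -> thread_src i \in branches h D.
Proof. by rewrite /thread_src; case: i.1 => dD; [apply: hub_branch | apply: mem_corner]. Qed.

Lemma thread_tgt_branch i : i.2 \in D -> thread_tgt D i \in branches h D.
Proof. by rewrite /thread_tgt => dD; apply: mem_corner; case: i.1; rewrite ?mem_next. Qed.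

Lemma thread_path i : i.2 \in D ->
  path (edge_rel E) (thread_src i) (rcons (thread_int i) (thread_tgt D i)).
Proof.
case: i => -[] d /= dD; first by case/and3P: wD => _ /allP/(_ d dD).
have [n [d1 [D' [dl [e /and3P[_ _ cD]]]]]] := wheel_front dD.
rewrite /thread_src /thread_int /thread_tgt /= (next_front e).
by move: cD; rewrite !rim_cons /= rcons_cat rcons_cons -cat_rcons cat_path => /andP[].
Qed.

(** Among threads only spokes have the hub as an end. Two segments with the same ends would succeed
    each other both ways around the rim, which then would have only two corners. *)
Lemma thread_ends i j : i.2 \in D -> j.2 \in D -> i <> j ->
  thread_src i \in [:: thread_src j; thread_tgt D j] ->
  thread_tgt D i \in [:: thread_src j; thread_tgt D j] -> False.
Proof.
have nD d : d \in D -> next D d \in D by rewrite mem_next.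
have uD := uniq_sectors wD.
case: i j => b d [b' d'] /= dD d'D neq; rewrite /thread_src /thread_tgt !inE /=.
case: b b' neq => -[] /= neq.
- move=> _ /orP[/eqP e|/eqP/corner_inj e]; first by have := corner_neq_hub dD; rewrite e eqxx.
  by apply: neq; rewrite e.
- by rewrite ![h == _]eq_sym !(negPf (corner_neq_hub _)) ?nD.
- rewrite (negPf (corner_neq_hub dD)) (negPf (corner_neq_hub (nD _ dD))) /=.
  move=> /eqP/corner_inj e1 /eqP/corner_inj e2; case/eqP: (next_neq uD dD (ltnW D3)).
  by rewrite e2 ?nD // e1.
- have inj d1 d2 d3 : d1 \in D -> d2 \in D -> d3 \in D ->
    (corner d1 == corner d2) || (corner d1 == corner d3) -> d1 = d2 \/ d1 = d3.
    by move=> i1 i2 i3 /orP[]/eqP/corner_inj-> //; [left|right].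
  move=> /(inj _ _ _ dD d'D (nD _ d'D))[e|e]; first by case: neq; rewrite e.
  move=> /(inj _ _ _ (nD _ dD) d'D (nD _ d'D))[e'|e'].
    by case/eqP: (next_next_neq uD d'D D3); rewrite -e.
  by case/eqP: (next_neq uD dD (ltnW D3)); rewrite e' -e.
Qed.

Lemma branches_card : #|branches h D| = (size D).+1.
Proof.
rewrite cardsE (card_uniqP _) /= ?size_map // (uniq_corners wD) andbT.
by apply/mapP => -[d /corner_neq_hub/eqP ne e]; apply: ne.
Qed.

Lemma wheel_verts_card : #|[set z in wheel_verts h D]| = (size (spokes D) + size (rim D)).+1.
Proof. by case/and3P: wD => u _ _; rewrite cardsE (card_uniqP u) /= size_cat. Qed.

Lemma thread_uniq i : i.2 \in D ->
  uniq (thread_src i :: rcons (thread_int i) (thread_tgt D i)).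
Proof.
move=> iD; rewrite /= mem_rcons inE rcons_uniq negb_or.
have out z : z \in branches h D -> z \notin thread_int i.
  by apply: contraL => /(thread_int_branch iD).
rewrite !out ?thread_src_branch ?thread_tgt_branch // andbT; apply/andP; split.
  case: i iD {out} => -[] d /= dD; rewrite /thread_src /thread_tgt /=.
    by rewrite eq_sym corner_neq_hub.
  apply: contraNneq (next_neq (uniq_sectors wD) dD (ltnW D3)) => /corner_inj e.
  by rewrite -e ?mem_next.
case: i iD {out} => b d /= /rot_to[n D' e]; apply/uniq_occP => z.
by have := wheel_occ z e; rewrite /thread_int; case: b => /=; clear; lia.
Qed.

(* A vertex set separated from the branch vertices by two vertices stays within
   a single thread, as two threads never have the same ends. *)
Lemma threads_independent i j x y W : i.2 \in D -> j.2 \in D -> i <> j ->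
  x \in thread_int i -> y \in thread_int j ->
  x \in W -> [disjoint W & branches h D] -> #|nbr E W| <= 2 -> y \notin W :|: nbr E W.
Proof.
move=> iD jD ij xi yj xW dW N2.
have notW z : z \in branches h D -> z \notin W by move=> zB; rewrite (disjointFl dW).
(* A thread whose interior meets [W] leaves it at two distinct vertices, and these already exhaust
   the neighbourhood of [W]. *)
have nbrs k z : k.2 \in D -> z \in thread_int k -> z \in W -> exists z1 z2,
    [/\ z1 \in thread_src k :: thread_int k, z2 \in rcons (thread_int k) (thread_tgt D k),
       z1 != z2 & nbr E W = [set z1; z2]].
  move=> kD zk zW.
  have [||z1 [z2 [i1 i2 ne n1 n2]]] := thread_nbrs (thread_path kD) (thread_uniq kD) zk zW.
  - exact/notW/thread_src_branch.
  - exact/notW/thread_tgt_branch.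
  exists z1, z2; split=> //; apply/esym/eqP; rewrite eqEcard subUset !sub1set n1 n2 /=.
  by rewrite cards2 ne.
have [z1 [z2 [i1 i2 ne eN]]] := nbrs i x iD xi xW.
have off k l z : k.2 \in D -> l.2 \in D -> k <> l -> z \in thread_int k ->
    z \notin thread_src l :: rcons (thread_int l) (thread_tgt D l).
  move=> kD lD kl zk; have zB := thread_int_branch kD zk.
  rewrite inE mem_rcons inE; apply/norP; split; last (apply/norP; split).
  - by apply: contraNneq zB => ->; apply: thread_src_branch.
  - by apply: contraNneq zB => ->; apply: thread_tgt_branch.
  - by apply/negP => zl; apply/kl/(thread_int_inj kD lD zk).
apply/negP; rewrite in_setU => /orP[yW|].
  (* If [W] also met thread [j], the same two neighbours would lie on both threads, hence be the
     ends of both. *)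
  have [w1 [w2 [j1 j2 _ eN']]] := nbrs j y jD yj yW.
  have onj z : z \in [set z1; z2] -> z \in thread_src j :: rcons (thread_int j) (thread_tgt D j).
    rewrite -eN eN' !inE mem_rcons => /orP[/eqP->|/eqP->]; last first.
      by move: j2; rewrite mem_rcons => ->; rewrite orbT.
    by move: j1; rewrite !inE => /orP[]->; rewrite ?orbT.
  have ends z : z \in [set z1; z2] -> z \in branches h D ->
      z \in [:: thread_src j; thread_tgt D j].
    move=> /onj; rewrite inE mem_rcons !inE => /or3P[->|->|] //; rewrite ?orbT //.
    by move=> /(thread_int_branch jD); rewrite !inE => /negPf->.
  have iends z : z \in [set z1; z2] -> z \notin thread_int i.
    by move=> /onj zj; apply: contraL zj => /(off i j _ iD jD ij).
  have e1 : z1 = thread_src i.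
    by move: i1; rewrite inE (negPf (iends _ _)) ?orbF ?set21 // => /eqP.
  have e2 : z2 = thread_tgt D i.
    by move: i2; rewrite mem_rcons inE (negPf (iends _ _)) ?orbF ?set22 // => /eqP.
  apply: (thread_ends iD jD ij).
    by rewrite -e1; apply: ends; rewrite ?set21 // e1 thread_src_branch.
  by rewrite -e2; apply: ends; rewrite ?set22 // e2 thread_tgt_branch.
(* If [y] were a neighbour of [W], it would lie on thread [i] as well as inside thread [j]. *)
have := off j i y jD iD (nesym ij) yj; rewrite inE mem_rcons inE eN !inE => + /orP[]/eqP ey.
  by rewrite ey; move: i1; rewrite inE => /orP[]->; rewrite ?orbT.
by rewrite ey; move: i2; rewrite mem_rcons inE => /orP[]->; rewrite ?orbT.
Qed.

(** The three disjoint paths are the spoke of [d], the spoke of the next sector followed backwards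
    along the segment of [d], and the spoke of the previous sector followed along its own
    segment. *)
Lemma hub_corner_linked W d : d \in D -> separates E W h (corner d) -> 2 < #|nbr E W|.
Proof.
move=> dD; have [n [d1 [D' [dl [e w]]]]] := wheel_front dD.
have /and3P[/uniq_occP u /allP sp cyc] := w.
have [s s1 sl] : [/\ path (edge_rel E) h (rcons (spoke d) (corner d)),
    path (edge_rel E) h (rcons (spoke d1) (corner d1))
  & path (edge_rel E) h (rcons (spoke dl) (corner dl))].
  by split; apply: sp; rewrite !inE ?mem_rcons ?mem_head ?eqxx ?orbT.
have [a al] : path (edge_rel E) (corner d) (rcons (segment d) (corner d1)) /\
    path (edge_rel E) (corner dl) (rcons (segment dl) (corner d)).
  move: cyc; have -> : rim (d :: d1 :: rcons D' dl) =
      corner d :: segment d ++ corner d1 :: (segment d1 ++ rim D') ++ corner dl :: segment dl.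
    by rewrite -cats1 !rim_cons rim_cat rim_cons -catA [rim [::]]/rim /= cats0.
  rewrite [cycle _ _]/= rcons_cat rcons_cons -cat_rcons cat_path last_rcons rcons_cat cat_path.
  by case/andP=> pa /and3P[_ _ pl]; split; [exact: pa | exact: pl].
apply: separated_by_three s (_ : path _ _ (rcons (spoke d1 ++ corner d1 :: rev (segment d)) _))
  (_ : path _ _ (rcons (spoke dl ++ corner dl :: segment dl) _)) _.
- rewrite rcons_cat rcons_cons -cat_rcons cat_path s1 last_rcons.
  exact/path_rev_ends/a/edge_rel_sym.
- by rewrite rcons_cat rcons_cons -cat_rcons cat_path sl last_rcons.
apply/uniq_occP => z; have := u z.
rewrite /wheel_verts -cats1 !spokes_cons !rim_cons spokes_cat rim_cat spokes_cons rim_cons !occE.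
clear; lia.
Qed.

(** Each of the two arcs between [x] and [y] has to cross the neighbourhood. *)
Lemma cycle_linked W c x y : cycle (edge_rel E) c -> uniq c -> x \in c -> y \in c ->
  separates E W x y ->
  exists z1 z2, [/\ z1 \in c, z2 \in c, z1 != z2, z1 \in nbr E W & z2 \in nbr E W].
Proof.
move=> + + xc; have [n c' e] := rot_to xc.
rewrite -(rot_cycle n) -(rot_uniq n) -(mem_rot n) e => cyc un yc sep.
have {}yc : y \in c'.
  move: yc; rewrite inE => /predU1P[eyx|//]; move: sep.
  by rewrite eyx /separates in_setU; case: (x \in W).
case/splitPr: yc e cyc un => p1 p2 e; rewrite [cycle _ _]/= rcons_cat rcons_cons.
rewrite -cat_rcons cat_path last_rcons => /andP[pth1 pth2] un.
have sep' : separates E W y x by rewrite /separates orbC.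
have [z1 i1 n1] := path_crosses pth1 sep; have [z2 i2 n2] := path_crosses pth2 sep'.
have cP z : (z \in c) = (z \in x :: p1 ++ y :: p2) by rewrite -e mem_rot.
exists z1, z2; split=> //.
- by rewrite cP inE mem_cat i1 orbT.
- by rewrite cP inE mem_cat inE i2 !orbT.
apply: contraTneq i1 => ->; move: un; rewrite cons_uniq cat_uniq => /and4P[_ _ /hasPn d _].
by apply: d; rewrite inE i2 orbT.
Qed.

Lemma wheel_vertsP x : x \in wheel_verts h D ->
  x \in branches h D \/ exists2 i, i.2 \in D & x \in thread_int i.
Proof.
rewrite inE mem_cat => /predU1P[->|]; first by left; apply: hub_branch.
case/orP=> [/mem_spokes[d dD xd]|/mem_rim[d dD]]; first by right; exists (true, d).
rewrite inE => /predU1P[->|xd]; first by left; apply: mem_corner.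
by right; exists (false, d).
Qed.

Lemma thread_int_verts i x : i.2 \in D -> x \in thread_int i -> x \in wheel_verts h D.
Proof.
case: i => b d /= dD; rewrite /thread_int inE mem_cat /= => xi.
apply/orP; right; apply/orP; case: b xi => xd; [left|right].
  by apply/mem_spokes; exists d.
by apply/mem_rim; exists d; rewrite // inE xd orbT.
Qed.

Lemma branch_verts x : x \in branches h D -> x \in wheel_verts h D.
Proof.
rewrite !inE mem_cat => /predU1P[->|/mapP[d dD ->]]; first by rewrite eqxx.
by apply/orP; right; apply/orP; right; apply/mem_rim; exists d; rewrite ?mem_head.
Qed.

(** For two separated corners the position of the hub decides. If it is not a neighbour of [W], it
    is separated from one of the corners; if it is, the rim provides two more neighbours. *)
Lemma wheel_linked3 : linked3 [set z in wheel_verts h D] E (branches h D).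
Proof.
split.
- by apply/subsetP => z zB; rewrite inE branch_verts.
- by rewrite branches_card.
- move=> W x; rewrite inE => xV xW dW.
  have notW z : z \in branches h D -> z \notin W by move=> zB; rewrite (disjointFl dW).
  have [xB|[i iD xi]] := wheel_vertsP xV; first by rewrite (negPf (notW x xB)) in xW.
  have [||z1 [z2 [_ _ ne n1 n2]]] := thread_nbrs (thread_path iD) (thread_uniq iD) xi xW.
  - exact/notW/thread_src_branch.
  - exact/notW/thread_tgt_branch.
  apply: leq_trans (subset_leq_card (_ : [set z1; z2] \subset _)); first by rewrite cards2 ne.
  by rewrite subUset !sub1set n1.
move=> W b b' + + bW b'W; rewrite !inE.
case/predU1P=> [eb|/mapP[d dD eb]] /predU1P[eb'|/mapP[d' d'D eb']];
  rewrite {}eb {}eb' in bW b'W.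
- by move: b'W; rewrite inE bW.
- by apply: (hub_corner_linked d'D); rewrite /separates bW b'W.
- by apply: (hub_corner_linked dD); rewrite /separates bW b'W orbT.
have [hW|hW] := boolP (h \in W).
  by apply: (hub_corner_linked d'D); rewrite /separates hW b'W.
have [hN|hN] := boolP (h \in nbr E W); last first.
  by apply: (hub_corner_linked dD); rewrite /separates bW [h \in _ :|: _]in_setU (negPf hW) hN orbT.
have /and3P[/= /andP[hV un] _ cyc] := wD.
have urim : uniq (rim D) by move: un; rewrite cat_uniq => /and3P[].
have inrim a : a \in D -> corner a \in rim D.
  by move=> aD; apply/mem_rim; exists a; rewrite ?mem_head.
have [|z1 [z2 [i1 i2 ne n1 n2]]] :=
  cycle_linked (W := W) cyc urim (inrim _ dD) (inrim _ d'D).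
  by rewrite /separates bW b'W.
have hz z : z \in rim D -> h != z.
  by apply: contraTneq => <-; apply: contra hV; rewrite mem_cat => ->; rewrite orbT.
apply: leq_trans (subset_leq_card (_ : [set h; z1; z2] \subset _)).
  by rewrite -setUA !cardsU1 cards1 !inE negb_or !hz // ne.
by rewrite !subUset !sub1set hN n1.
Qed.

End Fixed.

(** * The edges of a subdivided wheel *)

Lemma cycle_edges_sub E c : cycle (edge_rel E) c -> cycle_edges c \subset E.
Proof. by move=> cyc; apply/subsetP => _ /imsetP[x xc ->]; apply: (next_cycle cyc). Qed.

Lemma cycle_cycle_edges c : uniq c -> cycle (edge_rel (cycle_edges c)) c.
Proof. by move=> uc; apply: cycle_from_next => // x xc; apply/imsetP; exists x. Qed.

Lemma card_cycle_edges c : #|cycle_edges c| <= size c.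
Proof. by apply: leq_trans (leq_imset_card _ _) _; apply: card_size. Qed.

Definition spoke_edges h D := \bigcup_(d <- D) path_edges h (rcons (spoke d) (corner d)).

Definition wheel_edges h D := cycle_edges (rim D) :|: spoke_edges h D.

Lemma spoke_edges_cons h d D :
  spoke_edges h (d :: D) = path_edges h (rcons (spoke d) (corner d)) :|: spoke_edges h D.
Proof. exact: big_cons. Qed.

Lemma spoke_edgesP h D E :
  (spoke_edges h D \subset E) =
  all (fun d => path (edge_rel E) h (rcons (spoke d) (corner d))) D.
Proof.
elim: D => [|d D IHD] /=; first by rewrite /spoke_edges big_nil sub0set.
by rewrite spoke_edges_cons subUset IHD path_edgesP.
Qed.

Lemma wheel_edges_sub E h D : wheel_in E h D -> wheel_edges h D \subset E.
Proof.
by case/and3P=> _ sp cyc; rewrite subUset spoke_edgesP sp cycle_edges_sub.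
Qed.

Lemma wheel_in_edges E h D : wheel_in E h D -> wheel_in (wheel_edges h D) h D.
Proof.
case/and3P=> un _ _; rewrite /wheel_in un -spoke_edgesP subsetUr /=.
have /cycle_cycle_edges : uniq (rim D) by move: un; rewrite /= cat_uniq => /and4P[].
have : cycle_edges (rim D) \subset wheel_edges h D by apply: subsetUl.
by case: (rim D) => //= x p; apply: path_edge_relS.
Qed.

(** The rim has at most as many edges as vertices, and a spoke at most one edge more than it has
    interior vertices. *)
Lemma card_wheel_edges h D :
  #|wheel_edges h D| <= size (spokes D) + size (rim D) + size D.
Proof.
suff le : #|spoke_edges h D| <= size (spokes D) + size D.
  apply: leq_trans (leq_card_setU _ _) _.
  by have := card_cycle_edges (rim D); move: le; clear; lia.
elim: D => [|d D IHD]; first by rewrite /spoke_edges big_nil cards0.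
rewrite spoke_edges_cons spokes_cons size_cat; apply: leq_trans (leq_card_setU _ _) _.
have := card_path_edges h (rcons (spoke d) (corner d)); rewrite size_rcons.
by move: IHD => /=; clear; lia.
Qed.

Lemma wheel_edges_in h D e : e \in wheel_edges h D -> e \subset [set z in wheel_verts h D].
Proof.
case/setUP=> [/imsetP[x xr ->]|].
  apply/subsetP => z; rewrite !inE mem_cat => /orP[]/eqP->; last by rewrite mem_next xr !orbT.
  by rewrite xr !orbT.
elim: D => [|d D IHD]; first by rewrite /spoke_edges big_nil inE.
rewrite spoke_edges_cons => /setUP[/path_edges_in|/IHD] /subsetP s; apply/subsetP => z /s.
  rewrite !in_set /wheel_verts spokes_cons rim_cons !(inE, mem_cat, mem_rcons).
  by case/or3P=> ->; rewrite ?orbT.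
rewrite !in_set /wheel_verts spokes_cons rim_cons !(inE, mem_cat).
by case/or3P=> ->; rewrite ?orbT.
Qed.

(** * Growing, re-rooting and shrinking subdivided wheels *)

Lemma wheel_inP E h p r t D : wheel_in E h ((p, r, t) :: D) =
  [&& uniq (h :: (p ++ spokes D) ++ r :: t ++ rim D),
      path (edge_rel E) h (rcons p r),
      all (fun d => path (edge_rel E) h (rcons (spoke d) (corner d))) D
    & path (edge_rel E) r (rcons (t ++ rim D) r)].
Proof.
by rewrite /wheel_in /wheel_verts spokes_cons rim_cons [all _ (_ :: _)]/= -andbA -cat_cons.
Qed.

(** The reversed ear becomes a spoke at [x], which splits the segment containing [x] into two. *)
Lemma wheel_hub_ear E h D d x q : wheel_in E h D -> d \in D -> x \in segment d ->
  path (edge_rel E) x (rcons q h) -> uniq q ->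
  (forall z, z \in q -> z \notin wheel_verts h D) ->
  exists2 D', wheel_in E h D' & size D' = (size D).+1.
Proof.
move=> + dD xd pth uq qN; have [n D1 eD] := rot_to dD.
have {}qN z : z \in q -> z \notin wheel_verts h (d :: D1).
  by move/qN; rewrite -eD (perm_mem (wheel_verts_rot h n D)).
rewrite -(wheel_in_rot _ _ n) -(size_rot n) eD.
case: d xd qN {eD dD} => -[p r] t /= /splitPr[t1 t2] qN.
rewrite wheel_inP => /and4P[/uniq_occP un pr sp cyc].
exists ((p, r, t1) :: (rev q, x, t2) :: D1) => //; rewrite wheel_inP; apply/and4P; split=> //.
- apply/uniq_occP => z; have := un z; have := uniq_occP _ uq z.
  have : 0 < occ z q -> occ z (wheel_verts h ((p, r, t1 ++ x :: t2) :: D1)) = 0.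
    by rewrite occ_gt0 => /qN; rewrite -occ_gt0 -eqn0Ngt => /eqP.
  rewrite /wheel_verts !spokes_cons !rim_cons /spoke /corner /segment /= !occE; clear; lia.
- by rewrite /= sp andbT; apply: path_rev_ends pth; apply: edge_rel_sym.
- by rewrite rim_cons; move: cyc; rewrite /corner /segment /= -catA cat_cons.
Qed.

(** Symmetry of [K_4]: the three threads at [corner d1] become the spokes, and the new rim passes
    through [h], [corner d2] and [corner d3]. Threads now run in the opposite direction are
    reversed. *)
Lemma wheel_rehub E h d1 d2 d3 : wheel_in E h [:: d1; d2; d3] ->
  wheel_in E (corner d1)
    [:: (rev (spoke d1), h, spoke d2); (segment d1, corner d2, segment d2);
        (rev (segment d3), corner d3, rev (spoke d3))].
Proof.
have symE := @edge_rel_sym T E.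
case: d1 d2 d3 => -[p1 r1] t1 [[p2 r2] t2] [[p3 r3] t3].
rewrite !wheel_inP => /and4P[/uniq_occP un s1 /and3P[s2 s3 _]].
rewrite !rim_cons /spoke /corner /segment {1}/rim /= cats0 in s2 s3 *.
rewrite rcons_cat rcons_cons -cat_rcons cat_path last_rcons => /andP[a1].
rewrite rcons_cat rcons_cons -cat_rcons cat_path last_rcons => /andP[a2 a3].
apply/and4P; split.
- apply/(@uniq_occP T (_ :: _)) => z; have := un z.
  rewrite !spokes_cons !rim_cons /spoke /corner /segment /= !occE; clear; lia.
- exact: path_rev_ends.
- by rewrite a1 path_rev_ends.
- rewrite {1}/rim /= cats0 rcons_cat rcons_cons -cat_rcons cat_path last_rcons s2.
  rewrite rcons_cat rcons_cons -cat_rcons cat_path last_rcons a2.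
  exact: path_rev_ends s3.
Qed.

(** The spoke of [d2] is deleted, so its corner turns into an interior vertex of the merged
    segment. *)
Lemma wheel_drop E h d1 d2 D : wheel_in E h (d1 :: d2 :: D) ->
  wheel_in E h ((spoke d1, corner d1, segment d1 ++ corner d2 :: segment d2) :: D).
Proof.
case: d1 d2 => -[p1 r1] t1 [[p2 r2] t2]; rewrite !wheel_inP.
case/and4P=> /uniq_occP un s1 /andP[_ sp]; rewrite rim_cons => cyc.
apply/and4P; split=> //; last by rewrite -catA.
apply/uniq_occP => z; have := un z.
rewrite spokes_cons rim_cons /spoke /corner /segment /= !occE; clear; lia.
Qed.

End SubdividedWheels.

(** * A 3-connected graph contains a subdivided [K_4] *)

Section SmallWheel.
Variables (T : finType) (G : graph T).
Implicit Types (x y z u v : T) (p q : seq T) (d : sector T) (D : seq (sector T)).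
Hypothesis kG : k_connected 3 G.

(** A path is prolonged at its first vertex until all neighbours of that vertex lie on it;
    finiteness stops the process. *)
Lemma saturated_path : exists x p,
  [/\ x \in vset G, path (edge_rel (eset G)) x p, uniq (x :: p)
    & nbr (eset G) [set x] \subset p].
Proof.
have [x xG] : exists x, x \in vset G.
  by apply/set0Pn; rewrite -card_gt0; have := vset_card kG; clear; lia.
suff: forall n x p, #|T| - size p < n -> x \in vset G ->
    path (edge_rel (eset G)) x p -> uniq (x :: p) -> exists x p,
  [/\ x \in vset G, path (edge_rel (eset G)) x p, uniq (x :: p)
    & nbr (eset G) [set x] \subset p].
  by move=> h; apply: (h _ x [::] (ltnSn _)).
elim=> // n IHn {xG}x p ltn xG pth un.
have [sub|/subsetPn[y yN yp]] := boolP (nbr (eset G) [set x] \subset p).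
  by exists x, p.
have /nbrP[yx [w /set1P-> xy]] := yN; rewrite inE in yx.
have un' : uniq (y :: x :: p) by rewrite cons_uniq inE negb_or yx yp.
apply: (IHn y (x :: p)) => //.
- rewrite [size _]/=; have : (size p).+1 < #|T| by rewrite -[_.+2](card_uniqP un') max_card.
  by move: ltn; clear; lia.
- exact: adj_vset xy.
- by rewrite /= edge_rel_sym xy.
Qed.

(* A cycle through [x] with a chord from [x] to [u], and an ear joining the two
   arcs into which the chord cuts it. *)
Lemma exists_wheel3 : exists h D, wheel_in (eset G) h D /\ size D = 3.
Proof.
have symE := @edge_rel_sym T (eset G).
have [x [p0 [xG pth un /subsetP nb]]] := saturated_path.
have := degree_ge3 kG xG; set N := nbr _ _ in nb * => N3.
case: p0 => [|x1 p] in pth un nb *.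
  by have /card_gt0P[y /nb] : 0 < #|N| by apply: leq_trans N3.
have /card_gt1P[u [v [uN vN uv]]] : 1 < #|N :\ x1|.
  by have := cardsD1 x1 N; case: (_ \in _); move: N3; clear; lia.
(* The two neighbours of [x] besides [x1] are renamed in path order, so that the edge from [v] to
   [x] closes a cycle of which [x u] is a chord. *)
have [A [u' [D [v' [R [ep u'N v'N]]]]]] : exists A u (D : seq T) v R,
    [/\ p = A ++ u :: D ++ v :: R, edge_rel (eset G) x u & edge_rel (eset G) x v].
  have inp t : t \in N :\ x1 -> t \in p.
    by rewrite in_setD1 => /andP[tx1 /nb]; rewrite inE (negPf tx1).
  have ed t : t \in N :\ x1 -> edge_rel (eset G) x t.
    by rewrite in_setD1 => /andP[_ /nbrP[_ [w /set1P->]]].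
  have := inp v vN; case/splitPr: (inp u uN) => p1 p2.
  rewrite mem_cat inE eq_sym (negPf uv) /= => /orP[] /splitPr[q1 q2].
    by exists q1, v, q2, u, p2; split; rewrite ?ed // -catA.
  by exists p1, u, q1, v, q2; split; rewrite ?ed.
move: u' v' u'N v'N ep {uN vN uv} => {}u {}v xu xv ep {nb N3 N}.
rewrite {}ep in pth un.
move: pth; rewrite /= cat_path /= cat_path /= => /andP[xx1 /and5P[pA Au pD Dv _]].
have pG : {subset x1 :: A ++ u :: rcons D v <= vset G}.
  apply: (@path_vset _ _ x); rewrite /= cat_path /= rcons_path.
  by rewrite xx1 pA Au pD Dv.
have uG : u \in vset G by apply: pG; rewrite inE mem_cat mem_head !orbT.
have unm := uniq_occP _ un.
have dis (s1 s2 : seq T) : (forall z, occ z s1 + occ z s2 <= 1) ->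
  [disjoint [set z in s1] & [set z in s2]].
  move=> le; rewrite disjoints_subset; apply/subsetP => z; rewrite !inE.
  by rewrite -!occ_gt0; have := le z; clear; lia.
have sub (s : seq T) : {subset s <= vset G} -> [set z in s] \subset vset G.
  by move=> h; apply/subsetP => z; rewrite inE => /h.
(* The sets [A] and [D] of the ear are the two arcs left by deleting the ends [x] and [u] of the
   chord. *)
have [|||||||||a [b [q [aA bD pthq uq qN]]]] := three_connected_ear kG
  (A := [set z in x1 :: A]) (D := [set z in rcons D v]) (S := [set z in [:: x; u]])
  (x := x1) (y := v).
- by apply: sub => z zA; apply: pG; rewrite -cat_cons mem_cat zA.
- by apply: sub => z zD; apply: pG; rewrite -cat_cons mem_cat orbC inE zD orbT.
- by apply: sub => z; rewrite !inE => /orP[]/eqP->.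
- by rewrite cardsE; apply: leq_trans (card_size _) _.
- by apply: dis => z; have := unm z; rewrite !occE; clear; lia.
- by apply: dis => z; have := unm z; rewrite !occE; clear; lia.
- by apply: dis => z; have := unm z; rewrite !occE; clear; lia.
- by rewrite inE mem_head.
- by rewrite inE mem_rcons mem_head.
rewrite !inE in aA; rewrite inE in bD.
have {}qN z : 0 < occ z q -> occ z (x :: u :: (x1 :: A) ++ rcons D v) = 0.
  by rewrite occ_gt0 => /qN; rewrite !in_setU !in_set -!occ_gt0 !occE; clear; lia.
have pc : path (edge_rel (eset G)) x (rcons (x1 :: A) u).
  by rewrite /= rcons_path xx1 pA.
have pd : path (edge_rel (eset G)) u (rcons (rcons D v) x).
  by rewrite !rcons_path last_rcons pD Dv symE.
rewrite -[_ || _]/(a \in x1 :: A) in aA.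
have {}unm z : occ z (x :: (x1 :: A) ++ u :: rcons D v) <= 1.
  by have := unm z; rewrite !occE; clear; lia.
move: (x1 :: A) (rcons D v) aA bD pc pd qN unm => A' D' /splitPr[A1 A2] /splitPr[D1 D2].
rewrite !rcons_cat !rcons_cons -!cat_rcons !cat_path !last_rcons.
move=> /andP[xa au] /andP[ub bx] qN unm.
(* The hub is [x]. Its spokes are an arc to [a], the chord to [u] and an arc to [b]; the reversed
   ear closes the rim. *)
exists x, [:: (A1, a, A2); ([::], u, D1); (rev D2, b, rev q)]; split=> //.
apply/and3P; split.
- apply/(@uniq_occP T (_ :: _)) => z; have := unm z; have := qN z.
  have := uniq_occP _ uq z; rewrite !spokes_cons !rim_cons /spoke /corner /segment /=.
  by rewrite !occE; clear; lia.
- by rewrite /= xa /= xu /= andbT; apply: path_rev_ends bx.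
rewrite !rim_cons /rim /spoke /corner /segment /= cats0.
rewrite rcons_cat rcons_cons -cat_rcons cat_path last_rcons au.
rewrite rcons_cat rcons_cons -cat_rcons cat_path last_rcons ub.
exact: path_rev_ends pthq.
Qed.

End SmallWheel.

Lemma wheel_verts_sub (T : finType) (G : graph T) h (D : seq (sector T)) :
  wheel_in (eset G) h D -> 0 < size D -> [set z in wheel_verts h D] \subset vset G.
Proof.
case/and3P=> _ /allP sp cyc D0; have hG : h \in vset G.
  case: D D0 sp {cyc} => // d D _ /(_ d (mem_head _ _)).
  by case: (spoke d) => [|z p] /= /andP[] + _; rewrite edge_rel_sym => /adj_vset.
apply/subsetP => z; rewrite !inE mem_cat => /or3P[/eqP->//|/mem_spokes[d /sp pth zd]|zr].
  by apply: (path_vset pth); rewrite mem_rcons inE zd orbT.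
case: (rim D) zr cyc => //= x p zr pth; apply: (path_vset pth).
by rewrite mem_rcons.
Qed.

(** * The bound for the whole graph and the case of equality *)

Section Equality.
Variables (T : finType) (G : graph T).
Implicit Types (x y z u v h : T) (p q : seq T) (d : sector T) (D : seq (sector T)).
Hypothesis hG : super_minimally_connected 3 G.

Lemma wheel_bound h D : wheel_in (eset G) h D -> 2 < size D ->
  #|eset G| + 2 <= 2 * #|vset G|.
Proof.
move=> wD D3; have w0 := wheel_in_edges wD.
apply: (linked3_bound hG (V := [set z in wheel_verts h D]) (E := wheel_edges h D)
  (B := branches h D)).
- exact/(wheel_verts_sub wD)/ltnW/ltnW.
- exact: wheel_edges_sub.
- exact: wheel_edges_in.
- exact: (wheel_linked3 w0 D3).
rewrite (wheel_verts_card w0) (branches_card w0).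
by have := card_wheel_edges h D; clear; lia.
Qed.

(** By [threads_independent] both ends of the ear become branch vertices, which improves the
    constant of [wheel_bound] from 2 to 3. *)
Lemma crossing_ear_bound h D i j x y q : wheel_in (eset G) h D -> 2 < size D ->
  i.2 \in D -> j.2 \in D -> i <> j -> x \in thread_int i -> y \in thread_int j ->
  path (edge_rel (eset G)) x (rcons q y) -> uniq q ->
  (forall z, z \in q -> z \notin wheel_verts h D) ->
  #|eset G| + 3 <= 2 * #|vset G|.
Proof.
move=> wD D3 iD jD ij xi yj pth uq qN; have w0 := wheel_in_edges wD.
pose V := [set z in wheel_verts h D]; pose E := wheel_edges h D.
have sV : V \subset vset G by exact/(wheel_verts_sub wD)/ltnW/ltnW.
have EV e : e \in E -> e \subset V by apply: wheel_edges_in.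
have xV : x \in V by rewrite inE (thread_int_verts _ iD).
have yV : y \in V by rewrite inE (thread_int_verts _ jD).
have qV z : z \in q -> z \notin V by rewrite inE; apply: qN.
have xB := thread_int_branch w0 iD xi; have yB := thread_int_branch w0 jD yj.
have xy : x != y.
  by apply/eqP => exy; apply/ij/(thread_int_inj w0 iD jD xi); rewrite exy.
apply: (linked3_bound hG (V := ear_verts V q) (E := ear_edges E x y q)
  (B := y |: (x |: branches h D))).
- rewrite subUset sV /=; apply/subsetP => t; rewrite inE => tq.
  by apply: (path_vset pth); rewrite mem_rcons inE tq orbT.
- by rewrite subUset (wheel_edges_sub wD) -path_edgesP.
- exact: ear_edges_in.
- apply: ear_linked2 => //; first exact: (wheel_linked3 w0 D3).
    by move=> W; apply: (threads_independent w0 D3 iD jD).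
  by move=> W; apply: (threads_independent w0 D3 jD iD (nesym ij)).
rewrite (card_ear_verts uq qV) !cardsU1 xB (wheel_verts_card w0) (branches_card w0).
rewrite in_setU1 negb_or eq_sym xy yB.
have := card_ear_edges E x y q; have := card_wheel_edges h D.
by rewrite -/E; clear; lia.
Qed.

(** All vertices of the wheel are branch vertices, so super-minimality identifies it with [G]. *)
Lemma wheel_no_interior h D : wheel_in (eset G) h D -> 2 < size D ->
  (forall d, d \in D -> spoke d = [::] /\ segment d = [::]) -> wheel (size D) G.
Proof.
move=> wD D3 no; have w0 := wheel_in_edges wD.
have [es er] : spokes D = [::] /\ rim D = map (@corner T) D.
  elim: D no {wD D3 w0} => // d D IHD no.
  have [|es er] := IHD; first by move=> d' d'D; apply: no; rewrite inE d'D orbT.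
  have [e1 e2] := no d (mem_head _ _).
  by rewrite spokes_cons rim_cons es er e1 e2.
have lk := wheel_linked3 w0 D3.
have eB : branches h D = [set z in wheel_verts h D] by rewrite /branches /wheel_verts es er.
rewrite eB in lk.
have [eV eE] := super_minimal_eq hG (wheel_verts_sub wD (ltnW (ltnW D3)))
  (wheel_edges_sub wD) (@wheel_edges_in _ h D) lk.
exists h, (rim D); split.
- by rewrite er size_map.
- by have /and3P[] := wD; rewrite /wheel_verts es.
- by rewrite -eV /wheel_verts es.
rewrite -eE; congr (_ :|: _); apply/eqP; rewrite eqEsubset spoke_edgesP; apply/andP; split.
  apply/allP => d dD; have [-> _] := no d dD; rewrite /= andbT.
  by apply/imsetP; exists (corner d); rewrite // er map_f.
apply/subsetP => _ /imsetP[r + ->]; rewrite er => /mapP[d dD ->].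
have := subxx (spoke_edges h D); rewrite spoke_edgesP => /allP/(_ d dD).
by have [-> _] := no d dD; rewrite /= andbT.
Qed.

Lemma wheel_hub_grow h D : wheel_in (eset G) h D -> forall d x q, d \in D -> x \in segment d ->
  path (edge_rel (eset G)) x (rcons q h) -> uniq q ->
  (forall z, z \in q -> z \notin wheel_verts h D) ->
  exists h' D', wheel_in (eset G) h' D' /\ size D < size D'.
Proof.
move=> wD d x q dD xd pth uq qN.
have [D' wD' eD'] := wheel_hub_ear wD dD xd pth uq qN.
by exists h, D'; rewrite eD'.
Qed.

Hypothesis eqG : #|eset G| + 2 = 2 * #|vset G|.

Lemma no_crossing_ear h D i j x y q : wheel_in (eset G) h D -> 2 < size D ->
  i.2 \in D -> j.2 \in D -> i <> j -> x \in thread_int i -> y \in thread_int j ->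
  path (edge_rel (eset G)) x (rcons q y) -> uniq q ->
  (forall z, z \in q -> z \notin wheel_verts h D) -> False.
Proof.
move=> wD D3 iD jD ij xi yj pth uq qN.
by have := crossing_ear_bound wD D3 iD jD ij xi yj pth uq qN; move: eqG; clear; lia.
Qed.

(** With four or more sectors the situation contradicts [eqG]; with three the wheel really grows. *)
Lemma corner_ear h D i d x q : wheel_in (eset G) h D -> 2 < size D ->
  i.2 \in D -> x \in thread_int i -> d \in D ->
  corner d != thread_src h i -> corner d != thread_tgt D i ->
  path (edge_rel (eset G)) x (rcons q (corner d)) -> uniq q ->
  (forall z, z \in q -> z \notin wheel_verts h D) ->
  exists h' D', wheel_in (eset G) h' D' /\ size D < size D'.
Proof.
move=> wD D3 iD xi dD; rewrite /thread_src /thread_tgt => dsrc dtgt pth uq qN.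
have uD := uniq_sectors wD.
have [D4|D4] := ltnP 3 (size D).
  (* Delete the spoke to [corner d]: the ear now joins two threads of a smaller wheel. *)
  have eD : prev D d \in D by rewrite mem_prev.
  have [n [d1 [D1 [dl [e]]]]] := wheel_front wD D3 eD.
  have := next_front wD e; rewrite next_prev // => ed1; rewrite -{}ed1 in e *.
  set d0 := prev D d in eD e *; move: (rcons D1 dl) e => D' e {D1 dl}.
  move=> w; have wd := wheel_drop w; set d' := (_, _, _) in wd.
  have u' : uniq (d' :: D') by apply: uniq_sectors wd.
  have sD' : size D = (size D').+2 by rewrite -(size_rot n) e.
  have inD d1' : d1' \in D -> [\/ d1' = d0, d1' = d | d1' \in D'].
    rewrite -(mem_rot n) e !inE => /or3P[/eqP|/eqP|];
      by [constructor 1|constructor 2|constructor 3].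
  (* The thread of [x] does not end at [corner d], so it is neither the deleted spoke nor one of the
     two merged segments. *)
  have [i' [i'D ij' xi']] : exists i',
      [/\ i'.2 \in d' :: D', i' <> (false, d') & x \in thread_int i'].
    case: i iD xi dsrc dtgt => -[] di /= /inD[] edi xi dsrc dtgt.
    - by exists (true, d'); split=> //; [apply: mem_head | move: xi; rewrite edi].
    - by rewrite edi eqxx in dtgt.
    - by exists (true, di); split=> //; rewrite inE edi orbT.
    - by rewrite edi next_prev ?eqxx in dtgt.
    - by rewrite edi eqxx in dsrc.
    - exists (false, di); split=> //; first by rewrite inE edi orbT.
      by case=> eq; move: u'; rewrite /= -eq edi.
  case: (no_crossing_ear (i := i') (j := (false, d')) wd _ _ _ ij' xi' _ pth uq) => //.
  - by move: D4; rewrite sD'.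
  - exact: mem_head.
  - by rewrite /thread_int /segment /= mem_cat mem_head orbT.
  move=> z /qN; apply: contra; rewrite -(perm_mem (wheel_verts_rot h n D)) e.
  rewrite /wheel_verts !spokes_cons !rim_cons /d' /spoke /corner /segment /=.
  rewrite -!occ_gt0 !occE; clear; lia.
(* All vertices of a subdivided [K_4] look alike: make [corner d] the hub. *)
have [n [d2 [D1 [d3 [e w]]]]] := wheel_front wD D3 dD.
have sD : size D = 3 by apply/eqP; rewrite eqn_leq D4.
have e0 : D1 = [::].
  by apply/eqP; rewrite -size_eq0; move: sD; rewrite -(size_rot n) e /= size_rcons => -[->].
rewrite {}e0 /= in e w; have ud := uniq_sectors w.
have nd3 : next D d3 = d.
  rewrite -(next_rot n uD) e /=; move: ud; rewrite /= !inE !negb_or andbT.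
  by rewrite ![d3 == _]eq_sym => /andP[/andP[_ /negPf->] /negPf->]; rewrite eqxx.
have w' := wheel_rehub w; rewrite sD; set D' := [:: _; _; _] in w'.
have {}qN z : z \in q -> z \notin wheel_verts (corner d) D'.
  move=> /qN; apply: contra; rewrite -(perm_mem (wheel_verts_rot h n D)) e.
  rewrite /D' /wheel_verts !spokes_cons !rim_cons /spoke /corner /segment /=.
  rewrite -!occ_gt0 !occE; clear; lia.
(* The threads that avoid [corner d] are exactly those on the new rim. *)
have [d' d'D xd'] : exists2 d', d' \in D' & x \in segment d'.
  case: i iD xi dsrc dtgt => -[] di /=; rewrite -(mem_rot n) e !inE => /or3P[]/eqP-> xi dsrc dtgt.
  - by rewrite eqxx in dtgt.
  - by exists (rev (spoke d), h, spoke d2); rewrite ?inE ?eqxx.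
  - exists (rev (segment d3), corner d3, rev (spoke d3)); last by rewrite /segment /= mem_rev.
    by rewrite !inE eqxx !orbT.
  - by rewrite eqxx in dsrc.
  - by exists (segment d, corner d2, segment d2); rewrite ?inE ?eqxx ?orbT.
  - by rewrite nd3 eqxx in dtgt.
by have := wheel_hub_grow w' d'D xd' pth uq qN.
Qed.

Lemma wheel_grow h D : wheel_in (eset G) h D -> 2 < size D ->
  wheel (size D) G \/ exists h' D', wheel_in (eset G) h' D' /\ size D < size D'.
Proof.
move=> wD D3.
pose subdivided d := (spoke d != [::]) || (segment d != [::]).
have [/hasP[d dD]|] := boolP (has subdivided D); last first.
  move=> /hasPn no; left; apply: wheel_no_interior wD D3 _ => d /no.
  by rewrite negb_or !negbK => /andP[/eqP-> /eqP->].
move=> nonempty; right.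
have [i iD [x xi]] : exists2 i, i.2 \in D & exists x, x \in thread_int i.
  have ex (s : seq T) : s != [::] -> exists x, x \in s.
    by case: s => // z s _; exists z; rewrite mem_head.
  by case/orP: nonempty => /ex[x xi]; [exists (true, d) | exists (false, d)] => //; exists x.
pose V := [set z in wheel_verts h D]; pose A := [set z in thread_int i].
pose S := [set thread_src h i; thread_tgt D i].
have sV : V \subset vset G by exact/(wheel_verts_sub wD)/ltnW/ltnW.
have sA : A \subset V by apply/subsetP => z; rewrite !in_set => /(thread_int_verts _ iD).
have sS : S \subset V.
  by rewrite subUset !sub1set !in_set !branch_verts ?thread_src_branch ?thread_tgt_branch.
have cS : #|S| <= 2 by rewrite cards2; case: (_ != _).
have dAB : [disjoint A & branches h D].
  rewrite disjoints_subset; apply/subsetP => z; rewrite in_setC [z \in A]in_set.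
  by move=> zi; apply: (thread_int_branch wD iD zi).
have sSB : S \subset branches h D.
  by rewrite subUset !sub1set thread_src_branch ?thread_tgt_branch.
(* There are at least four branch vertices, and only two are ends of the thread. *)
have [y yB yS] : exists2 y, y \in branches h D & y \notin S.
  apply/subsetPn/negP => /subset_leq_card; rewrite (branches_card wD).
  by move: cS D3; clear; lia.
have [|||||||||a [b [q [aA bD pth uq qN]]]] := three_connected_ear hG.1
  (A := A) (D := V :\: (A :|: S)) (S := S) (x := x) (y := y).
- exact: subset_trans sV.
- by apply: subset_trans sV; apply: subsetDl.
- exact: subset_trans sV.
- exact: cS.
- by rewrite disjoints_subset setCD subsetU // subsetUl orbT.
- by rewrite disjoint_sym; apply: disjointWl sSB _; rewrite disjoint_sym.
- rewrite disjoints_subset; apply/subsetP => z.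
  by rewrite in_setD in_setC in_setU negb_or => /andP[/andP[]].
- by rewrite in_set.
- by rewrite in_setD in_setU negb_or yS (disjointFl dAB) // in_set branch_verts.
move: bD; rewrite in_setD in_setU negb_or => /andP[/andP[bA bS] bV].
have {}qN z : z \in q -> z \notin wheel_verts h D.
  move/qN; apply: contra => zV; have {}zV : z \in V by rewrite in_set.
  by rewrite !(in_setU, in_setD) zV andbT orbAC orbN.
rewrite in_set in aA; rewrite in_set in bA; rewrite in_set in bV.
move: bS; rewrite in_set2 negb_or => /andP[bsrc btgt].
have [|[j jD bj]] := wheel_vertsP bV; last first.
  case: (no_crossing_ear wD D3 iD jD _ aA bj pth uq qN) => eij.
  by rewrite eij bj in bA.
rewrite in_set inE => /predU1P[eb|/mapP[d' d'D eb]]; rewrite {}eb in pth bsrc btgt.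
  (* An ear ending at the hub cannot start on a spoke, since the ends of the thread are excluded. *)
  case: i iD aA bsrc btgt {xi A S sA sS cS dAB sSB yS bA} => -[] di diD ai; first by rewrite eqxx.
  by move=> _ _; have := wheel_hub_grow wD diD ai pth uq qN.
exact: corner_ear wD D3 iD aA d'D bsrc btgt pth uq qN.
Qed.

(** Growth must stop: a subdivided wheel with [size D] spokes has [size D + 1] branch vertices, at
    most [#|T|]. *)
Lemma equality_wheel : exists n, 3 <= n /\ wheel n G.
Proof.
have [h [D [wD eD]]] := exists_wheel3 hG.1.
have D3 : 2 < size D by rewrite eD.
have [n] := ubnP (#|T| - size D).
elim: n h D wD D3 {eD} => // n IHn h D wD D3 ltn.
have [wh|[h' [D' [wD' ltD]]]] := wheel_grow wD D3; first by exists (size D).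
have D'3 : 2 < size D' by apply: ltn_trans ltD.
apply: (IHn h' D') => //.
have := max_card (mem (branches h' D')); rewrite (branches_card wD').
by move: ltn ltD; clear; lia.
Qed.

End Equality.

(** * Counting in wheels, and the conclusion *)

Lemma card_wheel (T : finType) (G : graph T) n :
  3 <= n -> wheel n G -> #|vset G| = n.+1 /\ #|eset G| = 2 * n.
Proof.
move=> n3 [h [c [sc /= /andP[hc uc] eV eE]]].
split; first by rewrite eV cardsE (card_uniqP _) /= ?sc // hc.
have hin x : x \in c -> h != x by apply: contraTneq => <-.
have cyc : #|cycle_edges c| = n.
  (* Two vertices giving the same rim edge would be successors of each other, which a cycle of
     length at least three rules out. *)
  rewrite card_in_imset ?(card_uniqP uc) // => x y xc yc exy.
  have := set21 x (next c x); rewrite exy => /set2P[//|ex].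
  have := set22 x (next c x); rewrite exy => /set2P[ey|ey].
    by have := next_next_neq uc yc; rewrite -ex ey eqxx sc => /(_ n3).
  by have := next_neq uc xc; rewrite ey -ex eqxx sc => /(_ (ltnW n3)).
have spk : #|[set [set h; x] | x in c]| = n.
  rewrite card_in_imset ?(card_uniqP uc) // => x y xc yc exy.
  by have := set22 h x; rewrite exy => /set2P[exh|//]; have := hin x xc; rewrite exh eqxx.
rewrite eE cardsU cyc spk (_ : _ :&: _ = set0) ?cards0 ?subn0 ?mul2n ?addnn //.
apply/setP => e; rewrite !inE; apply/negP => /andP[/imsetP[x xc ->] /imsetP[y yc exy]].
have := set21 h y; rewrite -exy => /set2P[] eh; first by have := hin x xc; rewrite eh eqxx.
by have := hin (next c x); rewrite mem_next -eh eqxx => /(_ xc).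
Qed.

Theorem theorem1p12 (T : finType) (G : graph T)
    (hG : super_minimally_connected 3 G) :
  #|eset G| <= 2 * #|vset G| - 2 /\
  (#|eset G| = 2 * #|vset G| - 2 <-> exists n, 3 <= n /\ wheel n G).
Proof.
have [h [D [wD eD]]] := exists_wheel3 hG.1.
have le : #|eset G| + 2 <= 2 * #|vset G| by apply: (wheel_bound hG wD); rewrite eD.
split; first by move: le; clear; lia.
split=> [eq|[n [n3 /(card_wheel n3)[-> ->]]]]; last by clear; lia.
(* By [le] the subtraction in [eq] is not truncated. *)
by apply: equality_wheel => //; move: le eq; clear; lia.
Qed.
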